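(* Let $p$ be an odd prime and let $G$ be a finite $p$-group of nilpotency class at most $2$ and exponent $p$. If $G$ is capable, and $[G,G]$ is of rank $k$, then $G/Z(G)$ is of rank at most $2k+\binom{k}{2}$. Moreover, equality holds only if there exists a witness $H$ to the capability of $G$ such that $H_3$ is cyclic (possibly trivial).
   Context: A group $G$ is capable if there exists a group $H$ such that $G\cong H/Z(H)$; such an $H$ is called a witness to the capability of $G$. The groups $[G,G]$ and $G/Z(G)$ are elementary abelian $p$-groups here, and rank means dimension over $\mathbb{F}_p$. $H_3=[[H,H],H]$ is the third term of the lower central series of $H$. *)

(* Defs.v *)
From HB Require Import structures.
From mathcomp Require Import all_boot all_fingroup all_solvable.
From mathcomp Require Import boolp classical_sets.

Set Implicit Arguments.
Unset Strict Implicit.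
Unset Printing Implicit Defensive.

Local Open Scope classical_set_scope.
Local Open Scope quotient_scope.
Local Open Scope group_scope.

(* Witnesses to capability are not assumed finite, so the notions below are    *)
(* set up for an arbitrary [groupType].  The choice operator carried by a      *)
(* [groupType] is no restriction in the presence of the axioms of [boolp].     *)

Section AbstractGroups.
Variable H : groupType.

Definition gcenter : set H := [set z | forall x, commute z x].

Definition is_subgroup (A : set H) : Prop :=
  A 1 /\ (forall x y, A x -> A y -> A (x * y^-1)).

Definition generated_subgroup (A : set H) : set H := smallest is_subgroup A.

Definition commutator_subgroup (A B : set H) : set H :=
  generated_subgroup [set g | exists x y, [/\ A x, B y & g = [~ x, y]]].

Definition gamma3 : set H :=
  commutator_subgroup (commutator_subgroup setT setT) setT.

Definition is_cyclic (A : set H) : Prop :=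
  exists c, A = generated_subgroup [set c].

Definition center_eqv : rel H := fun x y => `[< gcenter (x^-1 * y) >].

Lemma gcenterM x y : gcenter x -> gcenter y -> gcenter (x * y).
Proof. by move=> cx cy z; apply/commute_sym/commuteM; apply/commute_sym. Qed.

Lemma gcenterV x : gcenter x -> gcenter x^-1.
Proof. by move=> cx z; apply/commute_sym/commuteV/commute_sym. Qed.

Lemma center_eqv_refl : reflexive center_eqv.
Proof.
by move=> x; apply/asboolP; rewrite mulVg => y; rewrite /commute mul1g mulg1.
Qed.

Lemma center_eqv_sym : symmetric center_eqv.
Proof.
by move=> x y; apply/asboolP/asboolP => /gcenterV; rewrite invgM invgK.
Qed.

Lemma center_eqv_trans : transitive center_eqv.
Proof.
move=> y x z /asboolP xy /asboolP yz; apply/asboolP.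
by have := gcenterM xy yz; rewrite -mulgA mulKVg.
Qed.

Canonical center_equiv :=
  EquivRel center_eqv center_eqv_refl center_eqv_sym center_eqv_trans.

(* The type H/Z(H) of cosets of the center. *)
Definition center_quot := {eq_quot center_eqv}.

HB.instance Definition _ := Choice.on center_quot.

Definition cq_pi (x : H) : center_quot := \pi_{eq_quot center_eqv} x.
Definition cq_repr (u : center_quot) : H := generic_quotient.repr u.

Lemma cq_reprK u : cq_pi (cq_repr u) = u.
Proof. exact: reprK. Qed.

Lemma cq_piP x y : cq_pi x = cq_pi y <-> gcenter (x^-1 * y).
Proof.
split=> [/eqmodP/asboolP //|cxy].
by apply/eqmodP; apply/asboolP.
Qed.

Definition cq_one : center_quot := cq_pi 1.
Definition cq_mul (u v : center_quot) : center_quot :=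
  cq_pi (cq_repr u * cq_repr v).
Definition cq_inv (u : center_quot) : center_quot := cq_pi (cq_repr u)^-1.

Lemma cq_piM x y : cq_mul (cq_pi x) (cq_pi y) = cq_pi (x * y).
Proof.
have /cq_piP cx := cq_reprK (cq_pi x).
have /cq_piP cy := cq_reprK (cq_pi y).
apply/cq_piP; move: (cq_repr _) (cq_repr _) cx cy => b a cx cy.
rewrite invgM -mulgA (mulgA a^-1) (cx y) mulgA.
exact: gcenterM.
Qed.

Lemma cq_piV x : cq_inv (cq_pi x) = cq_pi x^-1.
Proof.
have /cq_piP cx := cq_reprK (cq_pi x).
apply/cq_piP; rewrite invgK; move: (cq_repr _) cx => a cx.
have xE : a^-1 * x * a = x by rewrite cx mulKVg.
have -> : a * x^-1 = (a^-1 * x)^-1 by rewrite -[in LHS]xE invgM mulKVg.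
exact: gcenterV.
Qed.

Lemma cq_mulA : associative cq_mul.
Proof.
move=> u v w; rewrite -(cq_reprK u) -(cq_reprK v) -(cq_reprK w).
by rewrite !cq_piM mulgA.
Qed.

Lemma cq_mul1 : left_id cq_one cq_mul.
Proof. by move=> u; rewrite -(cq_reprK u) cq_piM mul1g. Qed.

Lemma cq_mulg1 : right_id cq_one cq_mul.
Proof. by move=> u; rewrite -(cq_reprK u) cq_piM mulg1. Qed.

Lemma cq_mulV : left_inverse cq_one cq_inv cq_mul.
Proof. by move=> u; rewrite -(cq_reprK u) cq_piV cq_piM mulVg. Qed.

Lemma cq_mulgV : right_inverse cq_one cq_inv cq_mul.
Proof. by move=> u; rewrite -(cq_reprK u) cq_piV cq_piM mulgV. Qed.

HB.instance Definition _ :=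
  isGroup.Build center_quot cq_mulA cq_mul1 cq_mulg1 cq_mulV cq_mulgV.

End AbstractGroups.

Arguments gcenter H : clear implicits.
Arguments gamma3 H : clear implicits.

Definition isomorphic (G K : groupType) : Prop :=
  exists f : {multiplicative G -> K}, bijective f.

Definition capability_witness (G H : groupType) : Prop :=
  isomorphic G (center_quot H).

Definition capable (G : groupType) : Prop :=
  exists H : groupType, capability_witness G H.

(* Main.v *)
Require Import Defs.
From HB Require Import structures.
From mathcomp Require Import boolp classical_sets.
From mathcomp Require Import all_boot all_fingroup all_solvable all_algebra.
From mathcomp Require Import mxabelem zify.

Set Implicit Arguments.
Unset Strict Implicit.
Unset Printing Implicit Defensive.

Import GRing.Theory.
Local Open Scope classical_set_scope.
Local Open Scope group_scope.

(* Let H be a witness. Commutation induces an alternating map                 *)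
(* U x U -> W := [G, G] with U := G / Z(G), and a pairing W x U -> H_3 that   *)
(* is nondegenerate on W and satisfies the Jacobi identity. Composing the     *)
(* pairing with the F_p-linear forms on H_3 gives a family of k x n matrices  *)
(* B. If x in U is killed by a form B of rank r on W, then                    *)
(* (u, v) |-> B([x, u], v) is a symmetric form on U factoring through a space *)
(* of dimension r, so 'C(r + 1, 2) linear conditions on x force               *)
(* [x, U] <= ker B. Iterating inside the successive kernels gives the bound,  *)
(* and the count is strict unless some B has rank k.                          *)
(* When a form B has rank k, let K be its kernel in H_3. In H/K the group H_3 *)
(* becomes cyclic and no element of [G, G] other than 1 becomes central, but  *)
(* other elements of Z(G) may lift to larger centers. These are cut back by   *)
(* twisting H by the bilinear map (x, y) |-> x^T y on G/[G, G] before         *)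
(* dividing by K: its commutator is nondegenerate, as G/[G, G] has rank at    *)
(* least 2 when G is not abelian.                                             *)

(** * Dimension count for brackets and pairings *)

(** The bound is a count of linear conditions. A stage of the count is a subspace M of U whose
    bracket with U lies in a subspace of W of codimension c; at the start M = U and c = 0. A form B
    whose restriction to that subspace has rank r > 0 has rank at most c + r on W. Requiring that B
    kill x therefore costs at most c + r conditions, and the symmetric form costs C(r + 1, 2) more
    ([bracket_rank_step]); the codimension becomes c + r. Meanwhile [rank_bound] grows by 2r + C(r,
    2) + cr, which covers the cost because c <= cr ([rank_boundD]). Once c = k, nondegeneracy of the
    bracket gives M = 0. Summing yields [bracket_dim_le]; the last stage can be tight only if its B
    has rank k.

    The group theory supplies the hypotheses of this count. Commutators in H depend only on images
    in G ([cover_commg_eq]), the Hall-Witt identity becomes the Jacobi identity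
    ([cover_commg_jacobi]), and lifts of [G, G] commute with lifts of Z(G)
    ([cover_commg_der_center]), so the pairing on W x U is well defined. [linearization] puts it in
    coordinates, [center_quotient_rank] runs the count, and [cyclic_gamma3_witness] turns a form of
    rank k into a new witness. *)

Definition rank_bound k := (2 * k + 'C(k, 2))%N.

Lemma rank_boundD c r : (0 < r)%N ->
  (rank_bound c + 'C(r.+1, 2) + (c + r) <= rank_bound (c + r))%N.
Proof.
case: r => // r _; rewrite /rank_bound !addnS.
have binD a b : ('C(a + b, 2) = 'C(a, 2) + 'C(b, 2) + a * b)%N.
  elim: b => [|b IH]; first by rewrite addn0 muln0 !addn0.
  by rewrite addnS !binS !bin1 IH; lia.
by rewrite !binS !bin1 !bin0 binD; nia.
Qed.

Section Bound.
Local Open Scope ring_scope.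
Variables (F : fieldType) (k n : nat).

Lemma mxrank_cap_ker m q (M : 'M[F]_(m, n)) (C : 'M_(n, q)) :
  (\rank M <= \rank (M :&: kermx C)%MS + q)%N.
Proof. by rewrite -(mxrank_mul_ker M C) addnC leq_add2l rank_leq_col. Qed.

Lemma card_ord_pair_leq r :
  #|[pred ij : 'I_r * 'I_r | (ij.1 <= ij.2)%N]| = 'C(r.+1, 2).
Proof.
rewrite -sum1_card.
rewrite -(pair_big_dep xpredT (fun i j : 'I_r => (i <= j)%N) (fun _ _ => 1%N)) /=.
rewrite (exchange_big_dep xpredT) //= -bin2_sum big_nat_recl // add0n big_mkord.
by apply: eq_bigr => j _; rewrite (big_ord_narrow (ltn_ord j)) sum1_card card_ord.
Qed.

(* [x *m D y] is the bracket of x and y; B stands for the pairing w B x^T.    *)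
Variables (D : 'rV[F]_n -> 'M[F]_(n, k)) (forms : 'M[F]_(k, n) -> Prop).
Hypothesis br_anti : forall x y, x *m D y = - (y *m D x).
Hypothesis br_nondeg : forall x : 'rV_n, (forall y, x *m D y = 0) -> x = 0.
Hypothesis jacobi : forall B, forms B -> forall x y z,
  x *m D y *m B *m z^T + y *m D z *m B *m x^T + z *m D x *m B *m y^T = 0.
Hypothesis sep : forall w : 'rV_k, (forall B, forms B -> w *m B = 0) -> w = 0.

Lemma bracket_rank_step (W : 'M[F]_k) (M : 'M[F]_n) B :
    forms B -> (forall x y : 'rV_n, (x <= M)%MS -> (x *m D y <= W)%MS) ->
  exists M' : 'M[F]_n,
    [/\ (forall x y : 'rV_n, (x <= M')%MS -> (x *m D y <= W :&: kermx B)%MS) &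
    (\rank M <= \rank M' + 'C((\rank (W *m B)).+1, 2) + \rank B)%N].
Proof.
move=> BB MW; pose r := \rank (W *m B).
pose N := (M :&: kermx B^T)%MS.
pose P := row_base (W *m B).
pose V := pinvmx P.
have PV : P *m V = 1%:M by rewrite /V mulmxVp // row_base_free.
(* The v i are dual to a basis of the row space of W B, so a symmetric form   *)
(* with rows in that space is 0 once it vanishes at all (v i, v j), i <= j.   *)
pose v (i : 'I_r) : 'rV_n := (col i V)^T.
pose I := [pred ij : 'I_r * 'I_r | (ij.1 <= ij.2)%N].
pose C := \matrix_(a < n, q < #|I|)
  (D (v (enum_val q).1) *m B *m (v (enum_val q).2)^T) a 0.
exists (N :&: kermx C)%MS; split; last first.
  have := mxrank_cap_ker N C; have IE : #|I| = 'C(r.+1, 2) by exact: card_ord_pair_leq.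
  have := mxrank_mul_ker M B^T; rewrite -/N.
  have : (\rank (M *m B^T) <= \rank B)%N by rewrite -(mxrank_tr B) mxrankM_maxr.
  move: IE; rewrite /r; lia.
move=> x y; rewrite sub_capmx => /andP[]; rewrite [(x <= N)%MS]sub_capmx.
move=> /andP[xM /sub_kermxP xB] /sub_kermxP xC.
rewrite sub_capmx MW //=; apply/sub_kermxP.
have Bx : B *m x^T = 0 by rewrite -[B]trmxK -trmx_mul xB trmx0.
(* As B kills x, the Jacobi identity for x, u, z loses its middle term and becomes symmetry in u and
   z. *)
have SC u z : x *m D u *m B *m z^T = x *m D z *m B *m u^T.
  have := jacobi BB x u z; rewrite -(mulmxA _ B x^T) Bx mulmx0 addr0.
  by rewrite (br_anti z x) !mulNmx => /eqP; rewrite subr_eq0 => /eqP.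
have Sij i j : x *m D (v i) *m B *m (v j)^T = 0.
  wlog le_ij : i j / (i <= j)%N.
    by move=> IH; have /orP[/IH//|/IH] := leq_total i j; rewrite SC.
  have Iij : (i, j) \in I by [].
  have := congr1 (fun Y : 'rV_#|I| => Y 0 (enum_rank_in Iij (i, j))) xC.
  rewrite [RHS]mxE => E; apply/rowP=> a; rewrite !ord1 [RHS]mxE -[RHS]E.
  rewrite -!(mulmxA x) [LHS]mxE [RHS]mxE.
  by apply: eq_bigr => b _; rewrite [C _ _]mxE enum_rankK_in //= !mulmxA.
have S0 u : (forall j, x *m D u *m B *m (v j)^T = 0) -> x *m D u *m B = 0.
  move=> H.
  have : (x *m D u *m B <= P)%MS by rewrite eq_row_base submxMr // MW.
  case/submxP=> Y YE; move: H; rewrite YE => H.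
  suff -> : Y = 0 by rewrite mul0mx.
  rewrite -[Y]mulmx1 -PV mulmxA; apply/rowP=> j.
  by have /rowP/(_ 0) := H j; rewrite /v trmxK colE mulmxA -colE [LHS]mxE => ->; rewrite !mxE.
(* Symmetry is used twice: the form vanishes on all pairs of the v j, hence on (v j, y), hence on
   (y, v j). *)
by apply: (S0 y) => j; rewrite SC (S0 (v j)) ?mul0mx.
Qed.

(** Induction on the rank of [W], each step passing to its intersection with the kernel of a form;
    [k - \rank W] is the codimension c of the count. *)
Lemma bracket_rank_le (W : 'M[F]_k) (M : 'M[F]_n) :
    (forall x y : 'rV_n, (x <= M)%MS -> (x *m D y <= W)%MS) ->
  (\rank M + rank_bound (k - \rank W) <= rank_bound k)%N /\
  ((0 < \rank W)%N -> (forall B, forms B -> ~~ row_free B) ->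
   (\rank M + rank_bound (k - \rank W) < rank_bound k)%N).
Proof.
have [m] := ubnP (\rank W); elim: m => // m IH in W M * => /ltnSE leWm MW.
have Wk := rank_leq_row W.
have [W0|W_gt0] := posnP (\rank W).
  split=> //; move: MW; have /eqP -> : W == 0 by rewrite -mxrank_eq0 W0.
  move=> MW; suff -> : M = 0 by rewrite mxrank0 mxrank0 subn0.
  apply/row_matrixP => i; rewrite row0; apply: br_nondeg => y.
  by apply/eqP; rewrite -submx0 MW ?row_sub.
have [B BB WB] : exists2 B, forms B & W *m B != 0.
  apply: contrapT => noB; move: W_gt0; rewrite lt0n mxrank_eq0 => /eqP[].
  apply/row_matrixP => i; rewrite row0; apply: sep => B BB.
  apply/eqP/negPn/negP => rB; apply: noB; exists B => //.
  by apply: contra rB; rewrite -row_mul => /eqP->; rewrite row0.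
have [M' [M'W rM]] := bracket_rank_step BB MW.
have r_gt0 : (0 < \rank (W *m B))%N by rewrite lt0n mxrank_eq0.
have Wr := mxrank_mul_ker W B.
have Br : (\rank B <= k - \rank W + \rank (W *m B))%N.
  have := mxrank_mul_ker 1%:M B; rewrite mul1mx mxrank1.
  have : (\rank (W :&: kermx B) <= \rank (1%:M :&: kermx B))%N.
    by rewrite mxrankS // capmxS // submx1.
  lia.
have ltWm : (\rank (W :&: kermx B)%MS < m)%N by lia.
have [le1 lt1] := IH _ _ ltWm M'W.
have kW : (k - \rank (W :&: kermx B)%MS = k - \rank W + \rank (W *m B))%N by lia.
have hb := rank_boundD (k - \rank W) r_gt0.
rewrite kW in le1 lt1; split; first lia.
(* Strictness is inherited from later stages. At the last stage the intersection is 0, so the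
   estimate c + r for the rank of [B] equals k, and a [B] that is not row free falls below it. *)
move=> _ noB; have [W'0|W'_gt0] := posnP (\rank (W :&: kermx B)%MS); last first.
  by have := lt1 W'_gt0 noB; lia.
have := noB _ BB; rewrite /row_free => Bk.
have : (\rank B < k)%N by rewrite ltn_neqAle Bk rank_leq_row.
lia.
Qed.

Lemma bracket_dim_le :
  (n <= rank_bound k)%N /\
  ((0 < k)%N -> n = rank_bound k -> exists2 B, forms B & row_free B).
Proof.
have [x y|le lt] := @bracket_rank_le 1%:M 1%:M; first by rewrite !submx1.
rewrite !mxrank1 subnn /rank_bound addn0 in le lt *; split=> // k_gt0 nE.
apply: contrapT => noB; suff: (n < n)%N by rewrite ltnn.
rewrite {2}nE; apply: lt => // B BB; apply/negP => fB; apply: noB.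
by exists B.
Qed.

End Bound.

(** * Groups that need not be finite *)

Lemma morph_one (G H : groupType) (f : G -> H) :
  {morph f : x y / x * y} -> f 1 = 1.
Proof. by move=> fM; apply: (mulgI (f 1)); rewrite -fM !mulg1. Qed.

Definition gmorphism (G H : groupType) (f : G -> H)
    (fM : {morph f : x y / x * y}) : UMagmaMorphism.type G H :=
  HB.pack f (isUMagmaMorphism.Build G H f (morph_one fM, fM)).

Section GroupTypeFacts.
Variable H : groupType.
Implicit Types x y z : H.

Lemma gcenter1 : gcenter H 1.
Proof. by move=> x; rewrite /commute mul1g mulg1. Qed.

Lemma gcenterX x i : gcenter H x -> gcenter H (x ^+ i).
Proof. by move=> cx y; apply/commute_sym/commuteX/commute_sym. Qed.

Lemma gcenter_conj x y : gcenter H x -> x ^ y = x.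
Proof. by move=> cx; rewrite conjgE cx mulKg. Qed.

Lemma hall_witt x y z :
  [~ x, y^-1, z] ^ y * [~ y, z^-1, x] ^ z * [~ z, x^-1, y] ^ x = 1.
Proof.
rewrite /commg /conjg !(invgM, invgK) -!mulgA.
by rewrite !(mulKg, mulKVg) mulVg.
Qed.

Lemma commMg_central x y z :
  gcenter H [~ x, z] -> [~ x * y, z] = [~ x, z] * [~ y, z].
Proof.
move=> c; rewrite -[in RHS](gcenter_conj y c) !commgEr conjgM.
by rewrite mulgA -conjMg mulgK.
Qed.

Lemma commgM_central x y z :
  gcenter H [~ x, y] -> [~ x, y * z] = [~ x, z] * [~ x, y].
Proof.
move=> c; rewrite -[in RHS](gcenter_conj z c) !commgEl conjgM.
by rewrite -mulgA -conjMg mulKVg.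
Qed.

Lemma subgroup_generated (A : set H) : is_subgroup (generated_subgroup A).
Proof.
split=> [B [[B1 _] _] //|x y Ax Ay B BP].
by case: (BP) => -[_ BV] AB; apply: BV; [apply: Ax | apply: Ay].
Qed.

Lemma generated_sub (A B : set H) :
  is_subgroup B -> A `<=` B -> generated_subgroup A `<=` B.
Proof. by move=> sB AB x; apply. Qed.

Lemma sub_generated (A : set H) : A `<=` generated_subgroup A.
Proof. by move=> x Ax B [_]; apply. Qed.

Lemma subgroupV (A : set H) x : is_subgroup A -> A x -> A x^-1.
Proof. by case=> A1 AV Ax; rewrite -[x^-1]mul1g; apply: AV. Qed.

Lemma subgroupM (A : set H) x y : is_subgroup A -> A x -> A y -> A (x * y).
Proof.
move=> sA Ax Ay; case: (sA) => _ AV; rewrite -[y]invgK; apply: AV => //.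
exact: subgroupV.
Qed.

Lemma subgroupX (A : set H) x i : is_subgroup A -> A x -> A (x ^+ i).
Proof.
move=> sA Ax; elim: i => [|i IH]; first by case: sA.
by rewrite expgS; apply: subgroupM.
Qed.

(** A subgroup of the powers of c is trivial or contains a power of c with exponent prime to p; in
    the latter case Bezout recovers c itself. *)
Lemma cyclic_generated_prime p c (S : set H) : prime p -> c ^+ p = 1 ->
  (forall a, S a -> exists i, a = c ^+ i) -> is_cyclic (generated_subgroup S).
Proof.
move=> p_pr cp Sc; have sA := subgroup_generated S.
set A := generated_subgroup S in sA *.
have Ac a : A a -> exists i, a = c ^+ i.
  have sC : is_subgroup [set a | exists i, a = c ^+ i].
    split=> [|_ _ [i ->] [j ->]]; first by exists 0%N.
    exists (i + j * p.-1)%N; rewrite expgnDr; congr (_ * _); apply: mulg1_eq.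
    by rewrite -expgnDr -mulnS prednK ?prime_gt0 // mulnC expgnA cp expg1n.
  exact: generated_sub sC Sc a.
have [[a Aa a1]|A1] := pselect (exists2 a, A a & a <> 1); last first.
  exists 1; apply/seteqP; split=> [a Aa|].
    suff -> : a = 1 by case: (subgroup_generated [set 1]).
    by apply: contrapT => a1; apply: A1; exists a.
  by apply: generated_sub => // _ ->; case: sA.
have [i ai] := Ac a Aa.
have cop : coprime i p.
  rewrite coprime_sym prime_coprime //; apply/negP => /dvdnP[j ij].
  by apply: a1; rewrite ai ij mulnC expgnA cp expg1n.
have [j cj] : exists j, c = a ^+ j.
  case: (posnP i) cop => [->|i_gt0 cop].
    by rewrite /coprime gcd0n => /eqP p1; rewrite p1 in p_pr.
  case: (egcdnP p i_gt0) => km kn; rewrite (eqP cop) => E _; exists km.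
  by rewrite ai -expgnA mulnC E addn1 expgS mulnC expgnA cp expg1n mulg1.
exists c; apply/seteqP; split=> [b Ab|].
  have [l ->] := Ac b Ab; apply: (subgroupX _ (subgroup_generated _)).
  exact: sub_generated.
by apply: generated_sub => // _ ->; rewrite cj; apply: (subgroupX _ sA).
Qed.

End GroupTypeFacts.

(** * Central extension by a bilinear cocycle *)

Section TwistedProduct.
Variables (H : groupType) (A : zmodType) (c : H -> H -> A).
Hypothesis cMl : forall x y z, c (x * y) z = (c x z + c y z)%R.
Hypothesis cMr : forall x y z, c x (y * z) = (c x y + c x z)%R.

Definition twisted : Type := (H * A)%type.
HB.instance Definition _ := Choice.on twisted.

Let mul (u v : twisted) : twisted := (u.1 * v.1, (u.2 + v.2 + c u.1 v.1)%R).
Let one : twisted := (1, 0%R).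
(** The correction term is [c u.1 u.1] because bilinearity gives c(x, x^-1) = - c(x, x). *)
Let inv (u : twisted) : twisted := (u.1^-1, (- u.2 + c u.1 u.1)%R).

Let c1l x : c 1 x = 0%R.
Proof. by apply: (addrI (c 1 x)); rewrite -cMl mul1g addr0. Qed.

Let c1r x : c x 1 = 0%R.
Proof. by apply: (addrI (c x 1)); rewrite -cMr mul1g addr0. Qed.

Let cVl x y : c x^-1 y = (- c x y)%R.
Proof. by apply: (addrI (c x y)); rewrite -cMl mulgV c1l subrr. Qed.

Let cVr x y : c x y^-1 = (- c x y)%R.
Proof. by apply: (addrI (c x y)); rewrite -cMr mulgV c1r subrr. Qed.

Let mulA : associative mul.
Proof.
move=> [x a] [y b] [z d]; rewrite /mul /= mulgA cMl cMr; congr (_, _).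
rewrite -!addrA; do 2 congr GRing.add.
by rewrite [RHS]addrCA [(c x z + _)%R]addrC (addrCA (c y z)) addrA addrCA !addrA.
Qed.

Let mul1 : left_id one mul.
Proof. by case=> x a; rewrite /mul /= mul1g c1l add0r addr0. Qed.

Let mulg1' : right_id one mul.
Proof. by case=> x a; rewrite /mul /= mulg1 c1r !addr0. Qed.

Let mulV : left_inverse one inv mul.
Proof.
case=> x a; rewrite /mul /inv /one /= mulVg cVl; congr (_, _).
by rewrite addrAC addrK addNr.
Qed.

Let mulV' : right_inverse one inv mul.
Proof.
case=> x a; rewrite /mul /inv /one /= mulgV cVr; congr (_, _).
by rewrite -addrA addrK subrr.
Qed.

HB.instance Definition _ := isGroup.Build twisted mulA mul1 mulg1' mulV mulV'.

Lemma twisted_product : exists (E : groupType) (i : H -> A -> E),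
  [/\ forall e, exists x a, e = i x a,
      forall x a y b, i x a = i y b -> x = y /\ a = b
    & forall x a y b, i x a * i y b = i (x * y) (a + b + c x y)%R].
Proof.
exists twisted, (fun x a => (x, a)); split=> // [[x a]|x a y b [-> ->] //].
by exists x, a.
Qed.

End TwistedProduct.

(** * Quotient by a central subgroup *)

Section Quotient.
Variables (E : groupType) (N : set E).
Hypotheses (sN : is_subgroup N) (cN : N `<=` gcenter E).
Local Open Scope quotient_scope.

Definition coset_eqv : rel E := fun x y => `[< N (x^-1 * y) >].

Let eqv_refl : reflexive coset_eqv.
Proof. by move=> x; apply/asboolP; rewrite mulVg; case: sN. Qed.

Let eqv_sym : symmetric coset_eqv.
Proof.
by move=> x y; apply/asboolP/asboolP => /(subgroupV sN); rewrite invgM invgK.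
Qed.

Let eqv_trans : transitive coset_eqv.
Proof.
move=> y x z /asboolP xy /asboolP yz; apply/asboolP.
by have := subgroupM sN xy yz; rewrite -mulgA mulKVg.
Qed.

Canonical coset_equiv := EquivRel coset_eqv eqv_refl eqv_sym eqv_trans.

Definition central_quot := {eq_quot coset_eqv}.
HB.instance Definition _ := Choice.on central_quot.

Let pi (x : E) : central_quot := \pi_{eq_quot coset_eqv} x.
Let rep (u : central_quot) : E := generic_quotient.repr u.

Let repK u : pi (rep u) = u. Proof. exact: reprK. Qed.

Let piP x y : pi x = pi y <-> N (x^-1 * y).
Proof. by split=> [/eqmodP/asboolP //|xy]; apply/eqmodP/asboolP. Qed.

Let mul (u v : central_quot) := pi (rep u * rep v).
Let inv (u : central_quot) := pi (rep u)^-1.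

Let piM x y : mul (pi x) (pi y) = pi (x * y).
Proof.
have /piP cx := repK (pi x); have /piP cy := repK (pi y).
apply/piP; move: (rep _) (rep _) cx cy => b a cx cy.
rewrite invgM -mulgA (mulgA a^-1) (cN cx y) mulgA.
exact: subgroupM.
Qed.

Let piV x : inv (pi x) = pi x^-1.
Proof.
have /piP cx := repK (pi x).
apply/piP; rewrite invgK; move: (rep _) cx => a cx.
have xE : a^-1 * x * a = x by rewrite (cN cx) mulKVg.
have -> : a * x^-1 = (a^-1 * x)^-1 by rewrite -[in LHS]xE invgM mulKVg.
exact: subgroupV.
Qed.

Let mulA : associative mul.
Proof.
by move=> u v w; rewrite -(repK u) -(repK v) -(repK w) !piM mulgA.
Qed.
Let mul1 : left_id (pi 1) mul.
Proof. by move=> u; rewrite -(repK u) piM mul1g. Qed.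
Let mul1' : right_id (pi 1) mul.
Proof. by move=> u; rewrite -(repK u) piM mulg1. Qed.
Let mulV : left_inverse (pi 1) inv mul.
Proof. by move=> u; rewrite -(repK u) piV piM mulVg. Qed.
Let mulV' : right_inverse (pi 1) inv mul.
Proof. by move=> u; rewrite -(repK u) piV piM mulgV. Qed.

HB.instance Definition _ := isGroup.Build central_quot mulA mul1 mul1' mulV mulV'.

Lemma central_quotient : exists (Q : groupType) (q : UMagmaMorphism.type E Q),
  (forall u, exists x, q x = u) /\ (forall x, q x = 1 <-> N x).
Proof.
have qM : {morph pi : x y / x * y} by move=> x y; rewrite -piM.
exists central_quot, (gmorphism qM); split=> [u|x]; first by exists (rep u); exact: repK.
have -> : (gmorphism qM x = 1) = (pi x = pi 1) by [].
rewrite piP mulg1; split=> /(subgroupV sN) //; by rewrite invgK.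
Qed.

End Quotient.

(** * Commutators in a witness *)

(** A witness seen as a surjection onto G with kernel Z(H), which avoids working with cosets of the
    center. *)
Definition central_cover (H : groupType) (gT : finGroupType) (G : {group gT})
    (f : H -> gT) : Prop :=
  [/\ forall h, f h \in G, forall x, x \in G -> exists h, f h = x
    & forall h, f h = 1 <-> gcenter H h].

Lemma capability_witnessP (gT : finGroupType) (G : {group gT}) (H : groupType) :
  capability_witness (subg_of G) H <->
  exists f : UMagmaMorphism.type H gT, central_cover G f.
Proof.
split=> [[f [g fK gK]]|[f [fG fS fZ]]].
  have gM := can2_gmulfM fK gK.
  have cqM : {morph @cq_pi H : x y / x * y} by move=> x y; rewrite -cq_piM.
  have g1 := morph_one gM.
  pose q h := sgval (g (cq_pi h)).
  have qM : {morph q : x y / x * y} by move=> x y; rewrite /q cqM gM.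
  exists (gmorphism qM); split=> [h|x xG|h]; first exact: subgP.
    exists (cq_repr (f (subg G x))).
    by rewrite /= /q cq_reprK fK subgK.
  have -> : gcenter H h <-> cq_pi h = 1.
    rewrite -[1]/(cq_pi 1) cq_piP mulg1.
    by split=> [/gcenterV|/gcenterV]; rewrite ?invgK.
  rewrite /= /q; split=> [E|->]; last by rewrite g1.
  apply: (can_inj gK); rewrite g1; apply: val_inj; exact: E.
have /choice[s sK] : forall x : subg_of G, exists h, f h = sgval x.
  by move=> x; apply/fS/subgP.
have sM : {morph (fun x => cq_pi (s x)) : x y / x * y}.
  move=> x y; transitivity (cq_pi (s x * s y)); last by rewrite -cq_piM.
  by apply/cq_piP/fZ; rewrite !gmulfM gmulfV !sK mulVg.
pose q : {multiplicative subg_of G -> center_quot H} :=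
  HB.pack (fun x => cq_pi (s x)) (isMultiplicative.Build _ _ _ sM).
exists q; exists (fun u => subg G (f (cq_repr u))) => [x|u].
  have /cq_piP/fZ := cq_reprK (q x); rewrite gmulfM gmulfV sK => /mulg1_eq.
  rewrite invgK => ->; exact: sgvalK.
rewrite -[u in RHS]cq_reprK; apply/cq_piP/fZ.
by rewrite gmulfM gmulfV sK subgK // mulVg.
Qed.

Section Cover.
Variables (gT : finGroupType) (G : {group gT}) (H : groupType).
Variable f : UMagmaMorphism.type H gT.
Hypothesis fP : central_cover G f.
Hypothesis class2 : [~: G, G] \subset 'Z(G).

Lemma cover_section : exists s : gT -> H, {in G, cancel s f}.
Proof.
case: fP => _ fS _.
have /choice[s sK] : forall x, exists h, x \in G -> f h = x.
  by move=> x; have [/fS[h hx]|//] := boolP (x \in G); [exists h | exists 1].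
by exists s.
Qed.

Lemma cover_commg_central h x : f h \in 'Z(G) -> gcenter H [~ h, x].
Proof.
case: fP => fG _ fZ hZ; apply/fZ; rewrite gmulfR.
by apply/eqP/commgP; case/centerP: hZ => _; apply.
Qed.

Lemma commg_mem_center x y : x \in G -> y \in G -> [~ x, y] \in 'Z(G).
Proof. by move=> xG yG; apply: (subsetP class2); apply: mem_commg. Qed.

(** Two lifts of the same element differ by a central factor, which commutators ignore. *)
Lemma cover_commg_eq h h' x x' :
  f h = f h' -> f x = f x' -> [~ h, x] = [~ h', x'].
Proof.
case: fP => _ _ fZ.
have E a a' b : f a = f a' -> [~ a, b] = [~ a', b].
  move=> aE; have : gcenter H (a'^-1 * a) by apply/fZ; rewrite gmulfM gmulfV aE mulVg.
  move: (a'^-1 * a) (mulKVg a' a) => z <- cz.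
  have z1 : [~ z, b] = 1 by apply/eqP/commgP/cz.
  by rewrite -(cz a') commMg_central z1 ?mul1g //; apply: gcenter1.
move=> hE xE; by rewrite (E _ h') // -[LHS]invgR -[RHS]invgR (E x x').
Qed.

(** As G has class at most 2, triple commutators in H are central. The conjugations in the Hall-Witt
    identity then disappear, and an inverted entry inverts the commutator. *)
Lemma cover_commg_jacobi (x y z : H) :
  [~ x, y, z] * [~ y, z, x] * [~ z, x, y] = 1.
Proof.
case: fP => fG _ _.
have aux (a b c : H) : [~ a, b^-1, c] ^ b = [~ a, b, c]^-1.
  have cab : f [~ a, b] \in 'Z(G) by rewrite gmulfR commg_mem_center.
  have cabV : f [~ a, b^-1] \in 'Z(G) by rewrite gmulfR commg_mem_center.
  rewrite (gcenter_conj _ (cover_commg_central _ cabV)).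
  apply/esym/mulg1_eq; rewrite -commMg_central; last exact: cover_commg_central.
  have -> : [~ [~ a, b] * [~ a, b^-1], c] = [~ 1, c]; last by rewrite comm1g.
  apply: cover_commg_eq => //.
  rewrite gmulf1 gmulfM !gmulfR gmulfV commgV ?mulgV //.
  have := commg_mem_center (fG a) (fG b); case/centerP => _ C.
  exact: commute_sym (C _ (fG b)).
have cc a b c : gcenter H [~ a, b, c].
  by apply: cover_commg_central; rewrite gmulfR commg_mem_center.
have := hall_witt x y z; rewrite !aux; move: (cc z x y) (cc y z x).
move: [~ x, y, z] [~ y, z, x] [~ z, x, y] => a b c /gcenterV cC /gcenterV bC E.
by apply: invg_inj; rewrite invg1 !invgM (cC _) (bC _) E.
Qed.

(** Three subgroups argument: for a lift x of a central element, [b, x] and [x, a] are central in H,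
    so the Jacobi identity leaves [a, b, x] = 1. *)
Lemma cover_commg_der_center h x :
  f h \in [~: G, G] -> f x \in 'Z(G) -> [~ h, x] = 1.
Proof.
case: fP => fG fS fZ hG' xZ.
have [s sK] := cover_section.
pose C := [set y in 'Z(G) | [~ s y, x] == 1]%SET.
have sCG y : y \in 'Z(G) -> y \in G by case/centerP.
have gC : group_set C.
  apply/group_setP; split=> [|a b]; rewrite ?[_ \in C]in_set.
    rewrite group1 (@cover_commg_eq _ 1 _ x) ?comm1g ?eqxx //.
    by rewrite sK ?group1 // gmulf1.
  case/andP=> aZ /eqP a1 /andP[bZ /eqP b1]; rewrite groupM //=.
  rewrite (@cover_commg_eq _ (s a * s b) _ x) //; last first.
    by rewrite gmulfM !sK ?groupM ?sCG.
  by rewrite commMg_central a1 ?b1 ?mulg1 //; apply: gcenter1.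
have : f h \in group gC.
  have : [~: G, G] \subset group gC; last by move/subsetP; apply.
  rewrite gen_subG; apply/subsetP=> _ /imset2P[a b aG bG ->].
  rewrite in_set commg_mem_center //=; apply/eqP.
  have -> : [~ s [~ a, b], x] = [~ s a, s b, x].
    apply: cover_commg_eq => //.
    by rewrite gmulfR !sK // groupR.
  have := cover_commg_jacobi (s a) (s b) x.
  have -> : [~ s b, x, s a] = 1.
    have /fZ cx : f [~ s b, x] = 1; last by apply/eqP/commgP/cx.
    by rewrite gmulfR; apply/eqP/commgP/commute_sym; case/centerP: xZ => _; apply.
  have -> : [~ x, s a, s b] = 1.
    have /fZ cx : f [~ x, s a] = 1; last by apply/eqP/commgP/cx.
    by rewrite gmulfR; apply/eqP/commgP; case/centerP: xZ => _; apply.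
  by rewrite !mulg1.
rewrite in_set => /andP[_ /eqP <-]; apply: cover_commg_eq => //.
by rewrite sK.
Qed.

End Cover.

(** * Linearization over F_p *)

Lemma abelem_coordinates p (gT : finGroupType) (E : {group gT}) :
    prime p -> p.-abelem E ->
  exists (u : gT -> 'rV['F_p]_('r(E))) (s : 'rV['F_p]_('r(E)) -> gT),
    [/\ {in E &, {morph u : x y / x * y >-> (x + y)%R}}, forall a, s a \in E,
        cancel s u & {in E, cancel u s}].
Proof.
move=> p_pr abE.
have : E \isog [set: 'rV['F_p]_('r(E))]%SET.
  rewrite (isog_abelem_card _ abE) mx_Fp_abelem //=.
  rewrite cardsT card_mx mul1n card_Fp // (rank_abelem abE).
  by rewrite -p_part part_pnat_id //; apply: abelem_pgroup abE.
case/isogP=> f injf fE.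
exists f, (invm injf); split=> [x y|a|a|x].
- exact: morphM.
- have aE : a \in f @* E by rewrite fE inE.
  by have := mem_morphim (invm_morphism injf) aE aE; rewrite /= im_invm.
- by rewrite invmK // fE inE.
- exact: invmE.
Qed.

Section FpAdditive.
Local Open Scope ring_scope.
Local Open Scope group_scope.
Variable p : nat.
Hypothesis p_pr : prime p.

Lemma Fp_scale_mulrn m n (a : 'F_p) (A : 'M['F_p]_(m, n)) : (a *: A = A *+ a)%R.
Proof. by rewrite -[in LHS](natr_Zp a) scaler_nat. Qed.

Lemma Fp_additive_mulmx m n (f : 'rV['F_p]_m -> 'rV['F_p]_n) :
    {morph f : x y / (x + y)%R} -> exists M, forall x, f x = (x *m M)%R.
Proof.
move=> fD; have f0 : f 0%R = 0%R by apply: (addrI (f 0%R)); rewrite -fD !addr0.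
have fn x i : f (x *+ i)%R = (f x *+ i)%R.
  by elim: i => [|i IH]; rewrite ?mulr0n ?mulrS ?fD ?IH.
exists (\matrix_i f (delta_mx 0 i))%R => x.
rewrite {1}(row_sum_delta x) (big_morph f fD f0) mulmx_sum_row.
by apply: eq_bigr => i _; rewrite rowK !Fp_scale_mulrn fn.
Qed.

(** Over the prime field an additively closed set containing 0 is a subspace, so some column of its
    cokernel matrix separates the point from it. *)
Lemma Fp_separation n (K : 'rV['F_p]_n -> Prop) a :
    K 0%R -> (forall x y, K x -> K y -> K (x + y)%R) -> ~ K a ->
  exists2 c : 'cV['F_p]_n, (forall x, K x -> x *m c = 0)%R & (a *m c != 0)%R.
Proof.
move=> K0 KD Ka; have KM x i : K x -> K (x *+ i)%R.
  by move=> Kx; elim: i => [|i IH] //; rewrite mulrS; apply: KD.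
pose S := (\sum_(x : 'rV['F_p]_n | `[< K x >]) <<x>>)%MS.
have aS : ~~ (a <= S)%MS.
  apply/negP => /sub_sumsmxP[u aE]; apply: Ka; rewrite aE.
  apply: big_ind => // x /asboolP Kx.
  have : (u x *m <<x>> <= x)%MS by rewrite (submx_trans (submxMl _ _)) // genmxE.
  by case/sub_rVP=> b ->; rewrite Fp_scale_mulrn; apply: KM.
have [j cj] : exists j, (a *m cokermx S) 0%R j != 0%R.
  apply/existsP; apply: contraR aS => /existsPn z; rewrite submxE.
  by apply/eqP/rowP=> j; have /negPn/eqP-> := z j; rewrite mxE.
exists (col j (cokermx S)) => [x Kx|].
  rewrite colE mulmxA; suff -> : (x *m cokermx S = 0)%R by rewrite mul0mx.
  apply/eqP; rewrite -submxE (submx_trans _ (sumsmx_sup x _ (submx_refl _))) ?genmxE //.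
  exact/asboolP.
apply: contraNneq cj => c0.
by have /matrixP/(_ 0%R 0%R) := c0; rewrite colE mulmxA -colE [LHS]mxE => ->; rewrite mxE.
Qed.

Variable H : groupType.

(** Matrices serve as the tensor product, [a^T *m b] being the pure tensor; [th] is the induced
    homomorphism. *)
Lemma bimultiplicative_factor k n (e : 'rV['F_p]_k -> 'rV['F_p]_n -> H) :
    (forall a b, gcenter H (e a b)) ->
    (forall a a' b, e (a + a')%R b = e a b * e a' b) ->
    (forall a b b', e a (b + b')%R = e a b * e a b') ->
  exists th : 'M['F_p]_(k, n) -> H,
    [/\ forall A, gcenter H (th A), forall A A', th (A + A')%R = th A * th A'
      & forall a b, e a b = th (a^T *m b)%R].
Proof.
move=> eC eDl eDr.
have e0l b : e 0%R b = 1 by apply: (mulgI (e 0%R b)); rewrite -eDl addr0 mulg1.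
have e0r a : e a 0%R = 1 by apply: (mulgI (e a 0%R)); rewrite -eDr addr0 mulg1.
have enl a b i : e (a *+ i)%R b = e a b ^+ i.
  by elim: i => [|i IH]; rewrite ?mulr0n ?mulrS ?expgS ?eDl ?IH.
have enr a b i : e a (b *+ i)%R = e a b ^+ i.
  by elim: i => [|i IH]; rewrite ?mulr0n ?mulrS ?expgS ?eDr ?IH.
(* Coordinates in F_p enter exponents as naturals below p, so sums and products of them agree only
   modulo p. *)
have ep a b i : e a b ^+ (i %% p) = e a b ^+ i.
  have ep1 : e a b ^+ p = 1.
    rewrite -enl -scaler_nat (_ : p%:R = 0 :> 'F_p)%R ?scale0r ?e0l //.
    exact: pchar_Fp_0.
  by rewrite [in RHS](divn_eq i p) expgnDr mulnC expgnA ep1 expg1n mul1g.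
pose d (i : 'I_k) (j : 'I_n) := e (delta_mx 0%R i) (delta_mx 0%R j).
have dC i j m : gcenter H (d i j ^+ m) by apply: gcenterX; apply: eC.
pose th (A : 'M['F_p]_(k, n)) := \prod_i \prod_j d i j ^+ A i j.
have pC (I : finType) (F : I -> H) : (forall i, gcenter H (F i)) -> gcenter H (\prod_i F i).
  move=> FC; apply: (big_ind (gcenter H)) => //; first exact: gcenter1.
  exact: gcenterM.
exists th; split=> [A|A A'|a b].
- by apply: (pC) => i; apply: (pC).
- rewrite -prodgM_commute; last by move=> i j _ _; apply: (pC).
  apply: eq_bigr => i _; rewrite -prodgM_commute; last by move=> j l _ _; apply: dC.
  apply: eq_bigr => j _; rewrite mxE -expgnDr -[in RHS]ep; congr (_ ^+ _).
  by congr (_ %% _)%N; apply: Fp_cast.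
- rewrite {1}(row_sum_delta a) (big_morph (e^~ b) (id1 := 1) (op1 := *%g)) //.
  apply: eq_bigr => i _.
  rewrite {1}(row_sum_delta b) (big_morph (e _) (id1 := 1) (op1 := *%g)) //.
  apply: eq_bigr => j _.
  rewrite !Fp_scale_mulrn enl enr -expgnA -/(d i j) -[LHS]ep; congr (_ ^+ _).
  by rewrite mxE big_ord1 !mxE mulnC; congr (_ %% _)%N; apply/esym/Fp_cast.
Qed.

End FpAdditive.

Lemma abelem_quotient_coordinates p (gT : finGroupType) (G N : {group gT}) :
    prime p -> N <| G -> p.-abelem (G / N) ->
  exists u : gT -> 'rV['F_p]_('r(G / N)),
    [/\ {in G &, {morph u : x y / x * y >-> (x + y)%R}},
        forall a, exists2 x, x \in G & u x = a
      & {in G, forall x, u x = 0%R <-> x \in N}].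
Proof.
move=> p_pr nNG abGN; have [u [s [uD sE sK uK]]] := abelem_coordinates p_pr abGN.
have nN := subsetP (normal_norm nNG).
have inq x : x \in G -> coset N x \in G / N by move=> xG; apply: mem_quotient.
exists (fun x => u (coset N x)); split=> [x y xG yG|a|x xG].
- by rewrite morphM ?nN // uD ?inq.
- have /morphimP[x _ xG E] := sE a; exists x => //.
  by rewrite -[RHS]sK E.
have u1 : u 1 = 0%R by apply: (addrI (u 1)); rewrite -uD ?group1 // mulg1 addr0.
split=> [ux|xN]; last by rewrite coset_id.
by apply: coset_idr; rewrite ?nN // -[LHS]uK ?inq // ux -u1 uK.
Qed.

Section Linearization.
Variables (p : nat) (gT : finGroupType) (G : {group gT}) (H : groupType).
Variable f : UMagmaMorphism.type H gT.
Hypotheses (p_pr : prime p) (expG : exponent G = p) (fP : central_cover G f).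
Hypothesis class2 : [~: G, G] \subset 'Z(G).

Let fG h : f h \in G. Proof. by case: fP. Qed.
Let fZ h : f h = 1 <-> gcenter H h. Proof. by case: fP. Qed.
Let cZ z x : z \in 'Z(G) -> x \in G -> commute z x.
Proof. by case/centerP=> _; apply. Qed.

Lemma der_abelem : p.-abelem [~: G, G].
Proof.
rewrite (abelemE [~: G, G]%G p_pr) -expG exponentS ?andbT.
  by apply: abelianS (center_abelian G).
exact: (der_sub 1 G).
Qed.

Lemma central_quotient_abelem : p.-abelem (G / 'Z(G)).
Proof.
by rewrite (abelemE (G / 'Z(G))%G p_pr) sub_der1_abelian //= -expG exponent_quotient.
Qed.

Lemma der_quotient_abelem : p.-abelem (G / [~: G, G]).
Proof.
by rewrite (abelemE (G / [~: G, G])%G p_pr) sub_der1_abelian //= -expG (exponent_quotient G [~: G, G]%G).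
Qed.

Lemma class2_commMg x y z : x \in G -> y \in G -> z \in G ->
  [~ x * y, z] = [~ x, z] * [~ y, z].
Proof.
move=> xG yG zG; rewrite commMgJ /conjg (cZ _ yG) ?mulKg //.
exact: commg_mem_center.
Qed.

Lemma class2_commgZ x x' y : x \in G -> x' \in G -> y \in G ->
  x^-1 * x' \in 'Z(G) -> [~ x', y] = [~ x, y].
Proof.
move=> xG x'G yG zZ; rewrite -{1}(mulKVg x x') class2_commMg ?groupM ?groupV //.
suff -> : [~ x^-1 * x', y] = 1 by rewrite mulg1.
by apply/eqP/commgP; apply: cZ.
Qed.

Let k := 'r([~: G, G]).
Let n := 'r(G / 'Z(G)).

Lemma linearization : exists (w : gT -> 'rV['F_p]_k) (u : gT -> 'rV['F_p]_n)
    (th : 'M['F_p]_(k, n) -> H),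
  [/\ [/\ {in [~: G, G] &, {morph w : x y / x * y >-> (x + y)%R}},
        forall a, exists2 x, x \in [~: G, G] & w x = a
      & {in [~: G, G], forall x, w x = 0%R <-> x = 1}],
      [/\ {in G &, {morph u : x y / x * y >-> (x + y)%R}},
        forall a, exists2 x, x \in G & u x = a
      & {in G, forall x, u x = 0%R <-> x \in 'Z(G)}]
    & [/\ forall A, gcenter H (th A), forall A A', th (A + A')%R = th A * th A'
      & forall h x, f h \in [~: G, G] ->
          [~ h, x] = th ((w (f h))^T *m u (f x))%R]].
Proof.
have [w [ws [wD wsG wsK wK]]] := abelem_coordinates (E := [~: G, G]%G) p_pr der_abelem.
have [u uP] := abelem_quotient_coordinates p_pr (center_normal G) central_quotient_abelem.
have [uD uS uZ] := uP.
have [s sK] := cover_section fP.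
have /choice[us usP] : forall a, exists x, x \in G /\ u x = a.
  by move=> a; have [x] := uS a; exists x.
have usG a : us a \in G by case: (usP a).
have usK a : u (us a) = a by case: (usP a).
have wsG' a : ws a \in G by apply: (subsetP (der_sub 1 G)); apply: wsG.
have wsZ a : ws a \in 'Z(G) by apply: (subsetP class2); apply: wsG.
have u1 : u 1 = 0%R by apply: (addrI (u 1)); rewrite -uD ?group1 // mulg1 addr0.
have uV x : x \in G -> u x^-1 = (- u x)%R.
  by move=> xG; apply: (addrI (u x)); rewrite -uD ?groupV // mulgV u1 subrr.
pose e a b := [~ s (ws a), s (us b)].
have eC a b : gcenter H (e a b).
  by apply: (cover_commg_central fP); rewrite sK.
have eDl a a' b : e (a + a')%R b = e a b * e a' b.
  rewrite -commMg_central; last exact: eC.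
  apply: (cover_commg_eq fP) => //; rewrite gmulfM !sK //.
  have inW c : ws c \in [~: G, G]%G by apply: wsG.
  rewrite -[RHS]wK ?groupM // wD ?inW // !wsK //.
(* If [u] agrees on the images of x and y, they differ by a lift of Z(G), which commutes with lifts
   of [G, G]. *)
have eu h x y : f h \in [~: G, G] -> u (f x) = u (f y) -> [~ h, x] = [~ h, y].
  move=> hW xy; rewrite -(mulKVg y x) commgM_central.
    rewrite [X in X * _](_ : _ = 1) ?mul1g //.
    apply: (cover_commg_der_center fP class2 hW); rewrite gmulfM gmulfV.
    by apply/uZ; rewrite ?groupM ?groupV ?fG // uD ?groupV ?fG // uV ?fG // xy addNr.
  by apply: (cover_commg_central fP); apply: (subsetP class2).
have eDr a b b' : e a (b + b')%R = e a b * e a b'.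
  rewrite [RHS](eC a b) -commgM_central; last exact: eC.
  by apply: eu; rewrite ?gmulfM !sK ?uD ?usK ?wsG.
have [th [thC thD thE]] := bimultiplicative_factor p_pr eC eDl eDr.
exists w, u, th; split=> //.
  split=> [//|a|x xG]; first by exists (ws a); [apply: wsG | apply: wsK].
  have w1 : w 1 = 0%R by apply: (addrI (w 1)); rewrite -wD ?group1 // mulg1 addr0.
  by split=> [x0|->//]; rewrite -(wK x xG) x0 -w1 wK ?group1.
split=> // h x hW; rewrite -thE /e.
transitivity [~ h, s (us (u (f x)))]; first by apply: eu; rewrite // sK ?usK.
by apply: (cover_commg_eq fP); rewrite // sK ?wK.
Qed.

(** In the equality case, [K] is the kernel of a form of rank k, and [t] is a vector on which the
    form is 1, so [t] generates the triple commutators modulo [K]. *)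
Lemma center_quotient_rank :
  (n <= rank_bound k)%N /\
  ((0 < k)%N -> n = rank_bound k -> exists (t : H) (K : set H),
     [/\ is_subgroup K, K `<=` gcenter H, gcenter H t /\ t ^+ p = 1,
       forall h x, f h \in [~: G, G] -> exists i, K ((t ^+ i)^-1 * [~ h, x])
     & forall h, f h \in [~: G, G] -> (forall x, K [~ h, x]) -> f h = 1]).
Proof.
have [w [u [th [[wD wS w0] [uD uS u0] [thC thD thE]]]]] := linearization.
have [s sK] := cover_section fP.
have GW x y : x \in G -> y \in G -> [~ x, y] \in [~: G, G].
  by move=> xG yG; apply: mem_commg.
have WG : {subset [~: G, G] <= G} by apply/subsetP; apply: (der_sub 1 G).
have u1 : u 1 = 0%R by apply/u0; rewrite ?group1.
have w1 : w 1 = 0%R by apply/w0; rewrite ?group1.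
have uV x : x \in G -> u x^-1 = (- u x)%R.
  by move=> xG; apply: (addrI (u x)); rewrite -uD ?groupV // mulgV u1 subrr.
have wV x : x \in [~: G, G] -> w x^-1 = (- w x)%R.
  by move=> xG; apply: (addrI (w x)); rewrite -wD ?groupV // mulgV w1 subrr.
have uE x y : x \in G -> y \in G -> u x = u y -> x^-1 * y \in 'Z(G).
  by move=> xG yG E; apply/u0; rewrite ?groupM ?groupV // uD ?groupV // uV // E addNr.
have /choice[us usP] : forall a, exists x, x \in G /\ u x = a.
  by move=> a; have [x] := uS a; exists x.
have usG a : us a \in G by case: (usP a).
have usK a : u (us a) = a by case: (usP a).
have /choice[D DE] : forall y, exists M, forall x, w [~ us x, us y] = (x *m M)%R.
  move=> y; apply: (Fp_additive_mulmx (f := fun x => w [~ us x, us y])) => x x'.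
  rewrite (@class2_commgZ (us x * us x')) ?uE ?groupM ?uD ?usK //.
  by rewrite class2_commMg // wD ?GW.
have brE x y : x \in G -> y \in G -> (u x *m D (u y))%R = w [~ x, y].
  move=> xG yG; rewrite -DE (@class2_commgZ x (us (u x))) ?uE ?usK //.
  by rewrite -invgR (@class2_commgZ y (us (u y)) x) ?uE ?usK // invgR.
have th0 : th 0%R = 1 by apply: (mulgI (th 0%R)); rewrite -thD addr0 mulg1.
have thN A : th (- A)%R = (th A)^-1.
  by apply: (mulgI (th A)); rewrite -thD subrr mulgV.
have thX A i : th (A *+ i)%R = th A ^+ i.
  by elim: i => [|i IH]; rewrite ?mulr0n ?mulrS ?expgS ?thD ?IH.
(* The linear forms on H_3, seen through th as forms on matrices.             *)
pose forms (B : 'M['F_p]_(k, n)) := forall A, th A = 1 -> (mxvec A *m (mxvec B)^T = 0)%R.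
have anti x y : (x *m D y = - (y *m D x))%R.
  have [a aG <-] := uS x; have [b bG <-] := uS y.
  by rewrite !brE // -wV ?GW // invgR.
have nondeg (x : 'rV_n) : (forall y, x *m D y = 0)%R -> x = 0%R.
  have [a aG <-] := uS x => a0; apply/u0 => //; apply/centerP; split=> // b bG.
  by apply/commgP/eqP/w0; rewrite ?GW // -brE.
have jacobi B : forms B -> forall x y z, (x *m D y *m B *m z^T + y *m D z *m B *m x^T
    + z *m D x *m B *m y^T = 0)%R.
  move=> BB x y z; have [a aG <-] := uS x; have [b bG <-] := uS y; have [c cG <-] := uS z.
  rewrite !brE // -!mxvec_dotmul -!mulmxDl -!linearD /=; apply: BB; rewrite !thD.
  have E a' b' c' : a' \in G -> b' \in G -> c' \in G ->
      th ((w [~ a', b'])^T *m u c')%R = [~ s a', s b', s c'].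
    by move=> aG' bG' cG'; rewrite thE gmulfR !sK ?GW.
  by rewrite !E // (cover_commg_jacobi fP class2).
have sep (a : 'rV_k) : (forall B, forms B -> a *m B = 0)%R -> a = 0%R.
  have [c cW <-] := wS a => cB; apply/w0 => //.
  apply: contrapT => c1.
  (* If c is not 1, its lift is not central; a linear form separating the resulting nonzero
     commutator from the kernel of [th] contradicts [cB]. *)
  have [x xG x1] : exists2 x, x \in G & [~ s c, s x] <> 1.
    apply: contrapT => nox; apply: c1; rewrite -[c]sK ?WG //; apply/fZ => h.
    apply/commgP/eqP; rewrite (@cover_commg_eq _ _ _ _ fP _ (s c) _ (s (f h))) ?sK ?fG ?WG //.
    by apply: contrapT => h1; apply: nox; exists (f h); rewrite ?fG.
  pose A := ((w c)^T *m u x)%R.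
  have [|||d dK] := @Fp_separation p _ (fun v => th (vec_mx v) = 1) (mxvec A).
  - by rewrite linear0.
  - by move=> v v' v1 v1'; rewrite linearD /= thD v1 v1' mulg1.
  - by rewrite mxvecK; move: x1; rewrite thE ?sK ?(WG c).
  case/eqP; have dE : d = ((mxvec (vec_mx d^T))^T)%R by rewrite vec_mxK trmxK.
  rewrite dE mxvec_dotmul cB ?mul0mx // => A' A'1.
  by rewrite -dE dK ?mxvecK.
have [le eqB] := bracket_dim_le anti nondeg jacobi sep.
split=> // k_gt0 nE; have [B BB fB] := eqB k_gt0 nE.
have [A0 A0B] : exists A0, (mxvec A0 *m (mxvec B)^T = 1%:M)%R.
  have /matrix0Pn[i [j Bij]] : B != 0%R.
    by apply: contraTneq fB => ->; rewrite /row_free mxrank0 eq_sym -lt0n.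
  exists ((B i j)^-1 *: ((delta_mx 0 i : 'rV_k)^T *m delta_mx 0 j))%R.
  rewrite linearZ /= -scalemxAl mxvec_dotmul -rowE trmx_delta -colE.
  by apply/matrixP=> a b; rewrite !ord1 !mxE mulVf.
pose K : set H := fun h => exists2 A, h = th A & (mxvec A *m (mxvec B)^T = 0)%R.
exists (th A0), K; split.
- split=> [|_ _ [A -> AB] [A' -> AB']]; first by exists 0%R; rewrite // linear0 mul0mx.
  by exists (A - A')%R; rewrite ?thD ?thN // linearB mulmxBl /= AB AB' subrr.
- by move=> _ [A -> _].
- split=> //; rewrite -thX -scaler_nat (_ : p%:R = 0 :> 'F_p)%R ?scale0r //.
  exact: pchar_Fp_0.
- move=> h x hW; pose A := ((w (f h))^T *m u (f x))%R.
  pose a := (mxvec A *m (mxvec B)^T)%R 0%R 0%R.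
  exists a; exists (- (A0 *+ a) + A)%R; first by rewrite thD thN thX thE.
  rewrite -Fp_scale_mulrn linearD linearN linearZ mulmxDl mulNmx /= -scalemxAl A0B.
  by rewrite [X in (_ + X)%R]mx11_scalar -/a scalemx1 addNr.
(* A form vanishes on the kernel of [th], so its value does not depend on the matrix [A] chosen for
   [h, s x]. Letting [u x] run over the unit vectors shows that [B] kills [w (f h)]. *)
move=> h hW hK; apply/w0 => //; apply: (row_free_inj fB); rewrite mul0mx.
apply/rowP=> j; have [x xG ux] := uS (delta_mx 0 j)%R.
have [A] := hK (s x); rewrite thE // sK // => AE AB.
have : (mxvec ((w (f h))^T *m u x - A) *m (mxvec B)^T = 0)%R.
  by apply: BB; rewrite thD thN AE mulgV.
rewrite linearB mulmxBl /= AB subr0 mxvec_dotmul ux trmx_delta -colE.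
by move=> /matrixP/(_ 0 0)%R; rewrite !mxE.
Qed.

End Linearization.

(** * A witness with cyclic third term *)

(** Testing on the unit vector at j, the entry (i, j) with i distinct from j reads a_i = 0. *)
Lemma tensor_sym_eq0 (F : fieldType) d (a : 'rV[F]_d) : (1 < d)%N ->
  (forall b : 'rV_d, a^T *m b = b^T *m a)%R -> a = 0%R.
Proof.
move=> d_gt1 sym; apply/rowP=> i.
have [j ji] : exists j : 'I_d, j != i.
  have [i0|i0] := eqVneq (val i) 0%N.
    by exists (Ordinal d_gt1); rewrite -val_eqE /= i0.
  by exists (Ordinal (ltnW d_gt1)); rewrite -val_eqE eq_sym.
have /matrixP/(_ i j) := sym (delta_mx 0 j)%R.
by rewrite !mxE !big_ord1 !mxE !eqxx mulr1 eq_sym (negPf ji) mul0r.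
Qed.

Lemma cyclic_gamma3_witness (p d : nat) (gT : finGroupType) (G : {group gT})
    (H : groupType) (f : UMagmaMorphism.type H gT) (t : H) (K : set H)
    (v : gT -> 'rV['F_p]_d) :
    prime p -> central_cover G f -> [~: G, G] \subset 'Z(G) ->
    is_subgroup K -> K `<=` gcenter H -> gcenter H t -> t ^+ p = 1 ->
    (forall h x, f h \in [~: G, G] -> exists i, K ((t ^+ i)^-1 * [~ h, x])) ->
    (forall h, f h \in [~: G, G] -> (forall x, K [~ h, x]) -> f h = 1) ->
    (1 < d)%N -> {in G &, {morph v : x y / x * y >-> (x + y)%R}} ->
    (forall a, exists2 x, x \in G & v x = a) ->
    {in G, forall x, v x = 0%R <-> x \in [~: G, G]} ->
  exists Q : groupType, capability_witness (subg_of G) Q /\ is_cyclic (gamma3 Q).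
Proof.
move=> p_pr fP class2 sK KZ tZ tp tK K1 d_gt1 vD vS v0.
have [fG fS fZ] := fP.
pose c h h' := ((v (f h))^T *m v (f h'))%R.
have cMl x y z : c (x * y) z = (c x z + c y z)%R.
  by rewrite /c gmulfM vD ?fG // linearD mulmxDl.
have cMr x y z : c x (y * z) = (c x y + c x z)%R.
  by rewrite /c gmulfM vD ?fG // mulmxDr.
have [E [i [iS iI iM]]] := twisted_product cMl cMr.
have i1 : i 1 0%R = 1.
  apply: (mulgI (i 1 0%R)); rewrite iM !mulg1 addr0 add0r.
  by have := cMl 1 1 1; rewrite mulg1 -[X in X = _]addr0 => /addrI <-.
have fR h h' : f [~ h, h'] \in [~: G, G] by rewrite gmulfR mem_commg.
have cW h h' : f h \in [~: G, G] -> c h h' = 0%R /\ c h' h = 0%R.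
  by move=> hW; rewrite /c; have -> : v (f h) = 0%R; [apply/v0 | rewrite trmx0 mul0mx mulmx0].
have iR h a h' a' : [~ i h a, i h' a'] = i [~ h, h'] (c h h' - c h' h)%R.
  apply: (mulgI (i h' a' * i h a)); rewrite -commgC !iM -commgC.
  have [_ ->] := cW _ (h' * h) (fR h h').
  by congr (i _ _); rewrite addr0 -[RHS]addrA [(c h' h + _)%R]addrC subrK [(a' + a)%R]addrC.
pose N : set E := fun e => exists2 h, e = i h 0%R & K h.
have iN h a : N (i h a) <-> K h /\ a = 0%R.
  by split=> [[x /iI[-> ->]]|[Kh ->]] //; exists h.
have iX h j : f h \in [~: G, G] -> i h 0%R ^+ j = i (h ^+ j) 0%R.
  move=> hW; elim: j => [|j IH]; first by rewrite !expg0 i1.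
  by rewrite !expgS IH iM (cW _ _ hW).1 !addr0.
have iV h : f h \in [~: G, G] -> (i h 0%R)^-1 = i h^-1 0%R.
  by move=> hW; apply: mulg1_eq; rewrite iM mulgV (cW _ _ hW).1 !addr0.
have fK h : K h -> f h = 1 by move=> /KZ/fZ.
have sN : is_subgroup N.
  split; first by exists 1; [rewrite i1 | case: sK].
  move=> _ _ [x -> Kx] [y -> Ky]; exists (x * y^-1); last by case: sK => _; apply.
  by rewrite iV ?fK // iM (cW _ _ _).1 ?addr0 ?fK.
have cN : N `<=` gcenter E.
  move=> _ [x -> Kx] e; have [y [a ->]] := iS e.
  rewrite /commute !iM (KZ x Kx y) addr0 add0r.
  by have [-> ->] : c x y = 0%R /\ c y x = 0%R by apply: cW; rewrite fK.
have [Q [q [qS qN]]] := central_quotient sN cN.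
have qE e e' : q e = q e' <-> N (e^-1 * e').
  rewrite -qN gmulfM gmulfV; split=> [->|/mulg1_eq]; first by rewrite mulVg.
  by rewrite invgK.
(* [g] picks the H-component of some lift; two such choices differ by an element of [K], so
   [f (g u)] depends on u alone. *)
have /choice[g gK] : forall u, exists h, exists a, q (i h a) = u.
  by move=> u; have [e <-] := qS u; have [h [a ->]] := iS e; exists h, a.
have gi h a : f (g (q (i h a))) = f h.
  have [b /qE[x xE Kx]] := gK (q (i h a)).
  have : i h a = i (g (q (i h a))) b * i x 0%R by rewrite -xE mulKVg.
  by rewrite iM => /iI[hE _]; rewrite {2}hE gmulfM (fK x) ?mulg1.
have fgM : {morph (fun u => f (g u)) : x y / x * y}.
  move=> x y; have [a xE] := gK x; have [b yE] := gK y.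
  by rewrite -{1}xE -{1}yE -gmulfM iM gi gmulfM.
exists Q; split.
  apply/capability_witnessP; exists (gmorphism fgM); split=> [u|x xG|u] /=.
  - exact: fG.
  - by have [h <-] := fS x xG; exists (q (i h 0%R)); rewrite gi.
  have [e <-] := qS u; have [h [a ->]] := iS e; rewrite gi.
  have comm h' a' : commute (q (i h a)) (q (i h' a')) <-> K [~ h, h'] /\ c h h' = c h' h.
    rewrite (rwP commgP) -(rwP eqP) -gmulfR qN iR iN.
    by split=> -[? cc]; split=> //; [apply: subr0_eq | rewrite cc subrr].
  split=> [h1 w|hZ].
    have [e' <-] := qS w; have [h' [a' ->]] := iS e'; apply/comm.
    have hZ : gcenter H h by apply/fZ.
    have -> : [~ h, h'] = 1 by apply/eqP/commgP/hZ.
    by split; [case: sK | have [-> ->] : c h h' = 0%R /\ c h' h = 0%R by apply: cW; rewrite h1].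
  (* Symmetry of the cocycle at h puts [f h] in [G, G]; only then does the hypothesis on [K] apply
     and give [f h = 1]. *)
  have hc h' : K [~ h, h'] /\ c h h' = c h' h by apply/(comm h' 0%R)/hZ.
  apply: K1 => [|h']; last by case: (hc h').
  apply/v0 => //; apply: tensor_sym_eq0 d_gt1 _ => b.
  by have [x xG <-] := vS b; have [h' <-] := fS x xG; case: (hc h').
pose C : set Q := fun u => exists2 h, exists a, u = q (i h a) & f h \in [~: G, G].
have sC : is_subgroup C.
  split; first by exists 1; [exists 0%R; rewrite i1 gmulf1 | rewrite gmulf1 group1].
  move=> _ _ [x [a ->] xW] [y [b ->] yW].
  have [h [a' hE]] := iS (i x a * (i y b)^-1).
  exists h; first by exists a'; rewrite -hE gmulfM gmulfV.
  have := congr1 (fun z => z * i y b) hE; rewrite /= mulgVK iM => /iI[xE _].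
  have : f x * (f y)^-1 \in [~: G, G] by rewrite groupM ?groupV.
  by rewrite xE gmulfM mulgK.
have gamma2C : commutator_subgroup [set: Q]%classic [set: Q]%classic `<=` C.
  apply: generated_sub => // _ [x [y [_ _ ->]]].
  have [e <-] := qS x; have [h [a ->]] := iS e.
  have [e' <-] := qS y; have [h' [a' ->]] := iS e'.
  by exists [~ h, h'] => //; exists (c h h' - c h' h)%R; rewrite -gmulfR iR.
have ft : f t = 1 by apply/fZ.
apply: (@cyclic_generated_prime _ p (q (i t 0%R))) => //.
  by rewrite -gmulfXn /= iX ?ft ?group1 // tp i1 gmulf1.
move=> _ [x [y [/gamma2C[h [a ->] hW] _ ->]]].
have [e <-] := qS y; have [h' [a' ->]] := iS e.
have [j Kj] := tK h h' hW; exists j.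
(* The cocycle vanishes as soon as one argument lies over [G, G], so the twist leaves triple
   commutators unchanged. *)
have [ch ch'] := cW h h' hW.
rewrite -gmulfR iR ch ch' subrr -gmulfXn /= iX ?ft ?group1 //.
apply/esym/qE; rewrite iV ?iM; last first.
  by rewrite gmulfXn /= ft expg1n group1.
rewrite !addr0 add0r (cW _ _ (fR h h')).2; apply/iN; split=> //.
Qed.

(** For abelian G all commutators of H are central, so the third term is trivial. *)
Lemma gamma3_cyclic_abelian (gT : finGroupType) (G : {group gT}) (H : groupType) :
  capability_witness (subg_of G) H -> abelian G -> is_cyclic (gamma3 H).
Proof.
case/capability_witnessP=> f [fG _ fZ] abG.
apply: (@cyclic_generated_prime _ 2 1) => // [|_ [x [y [x2 _ ->]]]]; first exact: expg1n.
exists 0%N; apply/eqP/commgP.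
suff : gcenter H x by apply.
apply: x2; split=> [|_ [a [b [_ _ ->]]]].
  split=> [|a b ca cb]; first exact: gcenter1.
  by apply: gcenterM => //; apply: gcenterV.
by apply/fZ; rewrite gmulfR; apply/eqP/commgP/(centsP abG).
Qed.

Theorem theorem6p13 (p : nat) (gT : finGroupType) (G : {group gT}) (k : nat)
    (p_prime : prime p) (p_odd : odd p)
    (pG : p.-group G) (class2G : nil_class G <= 2) (expG : exponent G = p)
    (capG : capable (subg_of G)) (rank_der : 'r([~: G, G]) = k) :
  ('r(G / 'Z(G)) <= 2 * k + 'C(k, 2))%N /\
  ('r(G / 'Z(G)) = (2 * k + 'C(k, 2))%N ->
   exists H : groupType,
     capability_witness (subg_of G) H /\ is_cyclic (gamma3 H)).
Proof.
have [H HG] := capG; have [f fP] := (capability_witnessP G H).1 HG.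
have nilG := pgroup_nil pG.
have class2 : [~: G, G] \subset 'Z(G) by rewrite -derg1 -nil_class2.
have [le eqK] := center_quotient_rank p_prime expG fP class2.
rewrite rank_der in le eqK; split=> // nE.
have [abG|nabG] := boolP (abelian G).
  by exists H; split=> //; apply: gamma3_cyclic_abelian HG abG.
have k_gt0 : (0 < k)%N.
  rewrite -rank_der rank_gt0; apply: contra nabG => /eqP W1.
  by rewrite /abelian (sameP commG1P eqP) W1.
have [t [K [sK KZ [tZ tp] tK K1]]] := eqK k_gt0 nE.
have [v [vD vS v0]] := abelem_quotient_coordinates p_prime (der_normal 1 G)
  (der_quotient_abelem p_prime expG).
apply: (cyclic_gamma3_witness p_prime fP class2 sK KZ tZ tp tK K1 _ vD vS v0).
(* If G/[G, G] were cyclic, the nilpotent group G would be cyclic, hence abelian. *)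
rewrite ltnNge -abelian_rank1_cyclic ?der_abelian ?sub_der1_abelian //.
by apply: contra nabG => /(cyclic_nilpotent_quo_der1_cyclic nilG)/cyclic_abelian.
Qed.
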